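(* Let $n\ge1$, let $d$ be an even positive integer, and let $\mathcal{A}=(a_{i_1\cdots i_d})\in\mathcal{S}_{n,d}$ be a tensor all of whose off-diagonal entries are non-positive, i.e. $a_{i_1 i_2\cdots i_d}\le 0$ whenever there exist $j,k$ with $i_j\neq i_k$. Then $\mathcal{A}\in\mathcal{C}_{n,d}$ if and only if $\mathcal{A}\in\mathcal{S}_{n,d}^{+}$.
   Context: $\mathcal{S}_{n,d}$ is the real vector space of symmetric tensors of order $d$ and dimension $n$ (arrays $(a_{i_1\cdots i_d})_{1\le i_1,\dots,i_d\le n}$ of reals invariant under permutations of indices). For $\mathbf{x}\in\mathbb{R}^n$, $\mathcal{T}_d(\mathbf{x})=\mathbf{x}\otimes\cdots\otimes\mathbf{x}$ ($d$ factors), and $\langle\mathcal{A},\mathcal{B}\rangle=\sum_{i_1,\dots,i_d}a_{i_1\cdots i_d}b_{i_1\cdots i_d}$. The positive semidefinite cone is $\mathcal{S}_{n,d}^{+}=\{\mathcal{A}\in\mathcal{S}_{n,d}:\langle\mathcal{A},\mathcal{T}_d(\mathbf{x})\rangle\ge0\ \forall\mathbf{x}\in\mathbb{R}^n\}$ and the copositive cone is $\mathcal{C}_{n,d}=\{\mathcal{A}\in\mathcal{S}_{n,d}:\langle\mathcal{A},\mathcal{T}_d(\mathbf{x})\rangle\ge0\ \forall\mathbf{x}\in\mathbb{R}^n_+\}$. *)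

(* Defs.v *)
From HB Require Import structures.
From mathcomp Require Import all_boot all_order all_fingroup all_algebra.
From mathcomp Require Import classical_sets reals.

Set Implicit Arguments.
Unset Strict Implicit.
Unset Printing Implicit Defensive.

Import Order.TTheory GRing.Theory Num.Theory.
Local Open Scope classical_set_scope.
Local Open Scope ring_scope.

(* The index i : {ffun 'I_d -> 'I_n} stands for the tuple (i_1, ..., i_d);
   indices are numbered from 0. *)
Definition tensor (R : realType) (n d : nat) := {ffun {ffun 'I_d -> 'I_n} -> R}.

Definition sym_tensors (R : realType) (n d : nat) : set (tensor R n d) :=
  [set A | forall (s : 'S_d) (i : {ffun 'I_d -> 'I_n}),
             A [ffun k => i (s k)] = A i].

Definition rank1_tensor (R : realType) (n d : nat) (x : 'rV[R]_n) :
    tensor R n d :=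
  [ffun i : {ffun 'I_d -> 'I_n} => \prod_(k < d) x ord0 (i k)].

Definition tensor_dot (R : realType) (n d : nat) (A B : tensor R n d) : R :=
  \sum_(i : {ffun 'I_d -> 'I_n}) A i * B i.

Definition psd_cone (R : realType) (n d : nat) : set (tensor R n d) :=
  [set A | sym_tensors A /\
           forall x : 'rV[R]_n, 0 <= tensor_dot A (rank1_tensor d x)].

Definition copositive_cone (R : realType) (n d : nat) : set (tensor R n d) :=
  [set A | sym_tensors A /\
           forall x : 'rV[R]_n, (forall j : 'I_n, 0 <= x ord0 j) ->
             0 <= tensor_dot A (rank1_tensor d x)].

(* Main.v *)
(* Replacing x by its entrywise absolute value |x| can only decrease the form
   <A, T_d(x)>: a diagonal term involves x_j^d = |x_j|^d since d is even, and
   every other coefficient is non-positive.  As |x| is a nonnegative vector,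
   copositivity bounds the smaller value from below by 0. *)
Require Import Defs.
From mathcomp Require Import all_boot all_order all_algebra.
From mathcomp Require Import classical_sets reals.
Import Order.TTheory GRing.Theory Num.Theory.
Local Open Scope ring_scope.

Lemma tensor_dot_norm_le (R : realType) (n d : nat) (A : tensor R n d)
    (x : 'rV[R]_n) :
  ~~ odd d ->
  (forall i : {ffun 'I_d -> 'I_n},
     (exists j k : 'I_d, i j <> i k) -> A i <= 0) ->
  tensor_dot A (rank1_tensor d (map_mx Num.norm x))
    <= tensor_dot A (rank1_tensor d x).
Proof.
move=> d_even Aoff; apply: ler_sum => i _; rewrite !ffunE.
under eq_bigr do rewrite mxE.
(* With [p] the product of the [x ord0 (i k)], the termwise claim is [A i * |p| <= A i * p]: it
   follows from [p <= |p|] if [A i <= 0], and from [|p| = p] if [i] is constant. *)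
rewrite -normr_prod.
have [/existsP[j /existsP[k /eqP ijk]]|] := boolP [exists j, exists k, i j != i k].
  by rewrite ler_wnM2l ?ler_norm//; apply: Aoff; exists j, k.
rewrite negb_exists => /forallP i_const.
(* Only [0 <= p] remains. The case [d = 0], with empty product 1, is split off so that [ord0]
   exists. *)
rewrite ger0_norm//; case: d => [|d] in A Aoff d_even i i_const *.
  by rewrite big_ord0.
have ik (k : 'I_d.+1) : i k = i ord0.
  by have:= i_const k; rewrite negb_exists => /forallP/(_ ord0)/negPn/eqP.
under eq_bigr do rewrite ik.
by rewrite prodr_const card_ord exprn_even_ge0.
Qed.

Theorem theorem1 (R : realType) (n d : nat) (hn : (1 <= n)%N)
    (hd : (0 < d)%N) (hd_even : ~~ odd d) (A : tensor R n d)
    (hsym : A \in @sym_tensors R n d)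
    (hoff : forall i : {ffun 'I_d -> 'I_n},
              (exists j k : 'I_d, i j <> i k) -> A i <= 0) :
  A \in @copositive_cone R n d <-> A \in @psd_cone R n d.
Proof.
(* Positive semidefinite implies copositive by restricting [x], which [//] settles; the other
   direction remains. *)
rewrite !in_setE; split=> -[symA A_ge0]; split=> // x.
apply: le_trans (tensor_dot_norm_le _ _ _ A x hd_even hoff).
by apply: A_ge0 => j; rewrite mxE normr_ge0.
Qed.
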